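(* Let $r$ and $s$ be arbitrary integer parameters. The three integers $$a = r^2(r^2+s^2)(r^8 + 2r^6s^2 - 12r^4s^4 - 6r^2s^6 - s^8)^2(r^{12} + 6r^{10}s^2 + 87r^8s^4 + 108r^6s^6 + 55r^4s^8 + 14r^2s^{10} + s^{12}),$$ $$b = s^2(r^2+s^2)(5r^6 + 3r^4s^2 + 3r^2s^4 + s^6)^2(r^8 + 2r^6s^2 - 12r^4s^4 - 6r^2s^6 - s^8)^2,$$ $$c = 4r^4s^4(5r^6 + 3r^4s^2 + 3r^2s^4 + s^6)^2(r^{12} + 6r^{10}s^2 + 87r^8s^4 + 108r^6s^6 + 55r^4s^8 + 14r^2s^{10} + s^{12})$$ are such that $a+b+c$, $ab+bc+ca$ and $abc$ are all perfect squares. This is a parametric solution, given by polynomials of degree 32, in which none of the three integers $a,b,c$ is a square, and all three integers are sums of two nonzero squares.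
   Context: A perfect square (or square) is the square of an integer; ''sums of two nonzero squares'' refers to squares of rational numbers. The problem being solved is that of finding three integers $a,b,c$ whose elementary symmetric functions $a+b+c$, $ab+bc+ca$, $abc$ are all perfect squares.
   Formalization: ''None is a square'' fails at (r,s)=(3,4); it is proved for a,b,c as polynomials and, with one parameter fixed nonzero, for all but finitely many values of the other. ''Sums of two nonzero squares'' is proved for polynomials and for r,s both nonzero (c=0 if rs=0). *)

(* Defs.v *)
From HB Require Import structures.
From mathcomp Require Import all_boot all_order all_algebra.
From mathcomp Require Import mpoly.
Set Implicit Arguments.
Unset Strict Implicit.
Unset Printing Implicit Defensive.
Import Order.TTheory GRing.Theory Num.Theory.
Local Open Scope ring_scope.

Definition is_square (R : nzRingType) (x : R) : Prop :=
  exists y : R, x = y ^+ 2.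

Definition sum_of_two_nonzero_squares (R : nzRingType) (x : R) : Prop :=
  exists y z : R, y != 0 /\ z != 0 /\ x = y ^+ 2 + z ^+ 2.

(* The formulas are given over an arbitrary commutative ring, so that the same
   definitions yield the integer values (R = int) and the polynomials in two
   indeterminates (R = {mpoly rat[2]}, evaluated at the indeterminates). *)
Definition factor6 (R : comNzRingType) (r s : R) : R :=
  5 * r ^+ 6 + 3 * r ^+ 4 * s ^+ 2 + 3 * r ^+ 2 * s ^+ 4 + s ^+ 6.

Definition factor8 (R : comNzRingType) (r s : R) : R :=
  r ^+ 8 + 2 * r ^+ 6 * s ^+ 2 - 12 * r ^+ 4 * s ^+ 4
    - 6 * r ^+ 2 * s ^+ 6 - s ^+ 8.

Definition factor12 (R : comNzRingType) (r s : R) : R :=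
  r ^+ 12 + 6 * r ^+ 10 * s ^+ 2 + 87 * r ^+ 8 * s ^+ 4
    + 108 * r ^+ 6 * s ^+ 6 + 55 * r ^+ 4 * s ^+ 8
    + 14 * r ^+ 2 * s ^+ 10 + s ^+ 12.

Definition sol_a (R : comNzRingType) (r s : R) : R :=
  r ^+ 2 * (r ^+ 2 + s ^+ 2) * factor8 r s ^+ 2 * factor12 r s.

Definition sol_b (R : comNzRingType) (r s : R) : R :=
  s ^+ 2 * (r ^+ 2 + s ^+ 2) * factor6 r s ^+ 2 * factor8 r s ^+ 2.

Definition sol_c (R : comNzRingType) (r s : R) : R :=
  4 * r ^+ 4 * s ^+ 4 * factor6 r s ^+ 2 * factor12 r s.

Definition Xr : {mpoly rat[2]} := 'X_ord0.
Definition Xs : {mpoly rat[2]} := 'X_ord_max.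
Definition poly_a : {mpoly rat[2]} := sol_a Xr Xs.
Definition poly_b : {mpoly rat[2]} := sol_b Xr Xs.
Definition poly_c : {mpoly rat[2]} := sol_c Xr Xs.

(* msize is one more than the total degree. *)
Definition has_degree (p : {mpoly rat[2]}) (d : nat) : Prop :=
  msize p = d.+1.

Definition none_square (R : nzRingType) (a b c : R) : Prop :=
  ~ is_square a /\ ~ is_square b /\ ~ is_square c.

Definition all_sums_of_two_nonzero_squares (R : nzRingType) (a b c : R) : Prop :=
  sum_of_two_nonzero_squares a /\ sum_of_two_nonzero_squares b /\
  sum_of_two_nonzero_squares c.

Definition nonsquare_at (r s : int) : Prop :=
  none_square (sol_a r s) (sol_b r s) (sol_c r s).

(* Main.v *)
Require Import Defs.
From HB Require Import structures.
From mathcomp Require Import all_boot all_order all_algebra.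
From mathcomp Require Import mpoly.
From mathcomp Require Import ring zify.
Set Implicit Arguments.
Unset Strict Implicit.
Unset Printing Implicit Defensive.
Import Order.TTheory GRing.Theory Num.Theory.
Local Open Scope ring_scope.

(** With f, g, h the factors of degree 6, 8, 12 and n = r^2 + s^2, one has
    a = (r g)^2 n h, b = (s f g)^2 n and c = (2 r^2 s^2 f)^2 h, and
    h = u^2 + v^2 with v = 4 r s n^2, so a, b, c are sums of two squares as soon
    as they are nonzero. The only factor whose nonvanishing is not a matter of
    signs is g, which is anisotropic modulo 3. Nonsquareness reduces to n, h and
    n h; each is q^2 + e (after scaling n h by 16^2) with deg e < deg q in either
    parameter, hence lies strictly between consecutive squares when that
    parameter is large (Runge). As polynomials, a, b, c take at (1, 1) the
    values 34, 2, 17 up to squares, and 34, 2, 17 are not rational squares. *)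

Lemma horner_rec_rcons (R : comNzRingType) (p : seq R) (c x : R) :
  horner_rec (rcons p c) x = horner_rec p x + c * x ^+ size p.
Proof.
elim: p => [|d p IHp] /=; first by rewrite expr0; ring.
by rewrite IHp exprS; ring.
Qed.

Definition abs_sum (p : seq int) : int := \sum_(c <- p) `|c|.

Lemma abs_sum_ge0 (p : seq int) : 0 <= abs_sum p.
Proof. exact: sumr_ge0. Qed.

Lemma norm_horner_rec_le (p : seq int) (x : int) (n : nat) :
  1 <= `|x| -> (size p <= n.+1)%N ->
  `|horner_rec p x| <= abs_sum p * `|x| ^+ n.
Proof.
move=> x1; rewrite /abs_sum; elim: p n => [|c p IHp] n /=.
  by rewrite big_nil normr0 mul0r.
rewrite ltnS big_cons => sz.
have xn : 1 <= `|x| ^+ n by rewrite exprn_ege1.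
rewrite mulrDl [leRHS]addrC; apply: le_trans (ler_normD _ _) _.
apply: lerD; last by rewrite ler_peMr.
case: n sz xn => [|n] sz xn.
  by move: sz; rewrite leqn0 => /nilP ->; rewrite /= mul0r normr0 big_nil mul0r.
by rewrite normrM exprSr mulrA ler_wpM2r // IHp.
Qed.

Definition eventually (P : int -> Prop) : Prop :=
  exists N : int, forall x : int, N < `|x| -> P x.

Lemma eventually_and (P Q : int -> Prop) :
  eventually P -> eventually Q -> eventually (fun x => P x /\ Q x).
Proof.
move=> [M HP] [N HQ]; exists (Num.max M N) => x.
by rewrite gt_max => /andP[/HP ? /HQ ?].
Qed.

Lemma eventually_impl (P Q : int -> Prop) :
  eventually P -> (forall x, P x -> Q x) -> eventually Q.
Proof. by move=> [N HP] PQ; exists N => x /HP /PQ. Qed.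

Lemma eventually_neq0 : eventually (fun x => x != 0).
Proof. by exists 0 => x; rewrite normr_gt0. Qed.

Lemma eventually_horner_rec_lt (p q : seq int) (c : int) :
  c != 0 -> (size p <= size q)%N ->
  eventually (fun x => `|horner_rec p x| < `|horner_rec (rcons q c) x|).
Proof.
move=> c0 szpq; exists (abs_sum p + abs_sum q + 1) => x Nx.
have [p0 q0] := (abs_sum_ge0 p, abs_sum_ge0 q).
have x1 : 1 <= `|x| by lia.
rewrite horner_rec_rcons addrC.
apply: lt_le_trans (lerB_normD _ _).
case: q szpq q0 Nx => [|d q] szpq q0 Nx.
  move: szpq; rewrite leqn0 => /nilP ->.
  by rewrite /= normr0 subr0 expr0 mulr1 normr_gt0.
have ple := norm_horner_rec_le x1 szpq.
have qle := norm_horner_rec_le x1 (leqnn (size (d :: q))).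
rewrite ltrBrDr (le_lt_trans (lerD ple qle)) // normrM normrX /= -mulrDl.
have c1 : 1 <= `|c| by rewrite -gtz0_ge1 normr_gt0.
apply: (@lt_le_trans _ _ (`|x| ^+ (size q).+1)).
  by rewrite exprS ltr_pM2r ?exprn_gt0 //; lia.
by rewrite ler_peMl // exprn_ge0.
Qed.

Lemma sqr_plus_small_nonsquare (q e : int) :
  e != 0 -> `|e| <= 2 * `|q| - 2 -> ~ is_square (q ^+ 2 + e).
Proof.
move=> e0 eq [y Hy].
have : `|y| ^+ 2 = `|q| ^+ 2 + e by rewrite !real_normK ?num_real.
have := normr_ge0 y; have := normr_ge0 q.
move: eq; move: `|q| `|y| => {}q {}y eq q0 y0 {}Hy.
have [yq|qy|E] := ltgtP y q; last first.
- by move: e0; rewrite (_ : e = 0) ?eqxx //; rewrite E in Hy; lia.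
- have : (q + 1) ^+ 2 <= y ^+ 2 by rewrite lerXn2r ?nnegrE //; lia.
  lia.
have : y ^+ 2 <= (q - 1) ^+ 2 by rewrite lerXn2r ?nnegrE //; lia.
lia.
Qed.

Lemma eventually_nonsquare (q e : seq int) (c d : int) :
  c != 0 -> d != 0 -> (size e < size q)%N ->
  eventually (fun x =>
    ~ is_square (horner_rec (rcons q c) x ^+ 2 + horner_rec (rcons e d) x)).
Proof.
move=> c0 d0 sz.
have Hlt := @eventually_horner_rec_lt (rcons e d) q c c0.
rewrite size_rcons in Hlt.
have Hne := @eventually_horner_rec_lt [::] e d d0 isT.
apply: (eventually_impl (eventually_and (Hlt sz) Hne)) => x [].
rewrite [horner_rec [::] x]/= normr0 normr_gt0 => lt_eq e0.
apply: sqr_plus_small_nonsquare => //.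
by move: lt_eq e0; lia.
Qed.

Lemma is_square_mulKl (d m : int) :
  d != 0 -> is_square (d ^+ 2 * m) -> is_square m.
Proof.
move=> d0 [y Hy].
have /dvdzP[k Hk] : (d %| y)%Z.
  by rewrite -(@dvdz_pexp2r _ _ 2) // -Hy dvdz_mulr.
exists k; apply: (mulfI (expf_neq0 2 d0)); rewrite Hy Hk; ring.
Qed.

Lemma is_square_mull (R : comNzRingType) (d m : R) :
  is_square m -> is_square (d ^+ 2 * m).
Proof. by move=> [y ->]; exists (d * y); rewrite exprMn. Qed.

Lemma is_square_ratz (m : int) : is_square (m%:~R : rat) -> is_square m.
Proof.
move=> [y Hy]; apply: (@is_square_mulKl (denq y)); first exact: denq_neq0.
exists (numq y); apply: (@intr_inj rat).
rewrite rmorphM !rmorphXn /= Hy -exprMn mulrC; congr (_ ^+ 2).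
by rewrite -{1}(divq_num_den y) divfK // intr_eq0 denq_neq0.
Qed.

Lemma is_square_rat_mulKl (d : rat) (m : int) :
  d != 0 -> is_square (d ^+ 2 * m%:~R) -> is_square m.
Proof.
move=> d0 [y Hy]; apply: is_square_ratz; exists (y / d).
by rewrite expr_div_n -Hy mulrC mulKf // expf_neq0.
Qed.

Section Identities.

Variables (R : comNzRingType) (r s : R).

Local Notation f := (factor6 r s).
Local Notation g := (factor8 r s).
Local Notation h := (factor12 r s).

Lemma factor12_sum_of_squares :
  h = (r ^+ 6 - 5 * r ^+ 4 * s ^+ 2 - r ^+ 2 * s ^+ 4 + s ^+ 6) ^+ 2
      + (4 * r * s * (r ^+ 2 + s ^+ 2) ^+ 2) ^+ 2.
Proof. rewrite /factor12; ring. Qed.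

Lemma sol_sum_is_square : is_square (sol_a r s + sol_b r s + sol_c r s).
Proof.
exists (r ^+ 16 + 18 * r ^+ 14 * s ^+ 2 + 16 * r ^+ 12 * s ^+ 4
  + 150 * r ^+ 10 * s ^+ 6 + 222 * r ^+ 8 * s ^+ 8 + 142 * r ^+ 6 * s ^+ 10
  + 48 * r ^+ 4 * s ^+ 12 + 10 * r ^+ 2 * s ^+ 14 + s ^+ 16).
rewrite /sol_a /sol_b /sol_c /factor6 /factor8 /factor12; ring.
Qed.

Lemma sol_pair_sum_is_square :
  is_square (sol_a r s * sol_b r s + sol_b r s * sol_c r s
             + sol_c r s * sol_a r s).
Proof.
pose m := r ^+ 16 + 8 * r ^+ 14 * s ^+ 2 + 100 * r ^+ 12 * s ^+ 4
  + 288 * r ^+ 10 * s ^+ 6 + 358 * r ^+ 8 * s ^+ 8 + 232 * r ^+ 6 * s ^+ 10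
  + 84 * r ^+ 4 * s ^+ 12 + 16 * r ^+ 2 * s ^+ 14 + s ^+ 16.
have Hm : m ^+ 2 = (r ^+ 2 + s ^+ 2) * h * ((r ^+ 2 + s ^+ 2) * g ^+ 2
    + 4 * r ^+ 2 * s ^+ 4 * f ^+ 2 + 4 * r ^+ 4 * s ^+ 2 * h).
  by rewrite /m /factor6 /factor8 /factor12; ring.
exists (r * s * f * g * m); rewrite [RHS]exprMn Hm /sol_a /sol_b /sol_c.
ring.
Qed.

Lemma sol_prod_is_square : is_square (sol_a r s * sol_b r s * sol_c r s).
Proof.
exists (2 * r ^+ 3 * s ^+ 3 * (r ^+ 2 + s ^+ 2) * f ^+ 2 * g ^+ 2 * h).
rewrite /sol_a /sol_b /sol_c; ring.
Qed.

Lemma sol_aE : sol_a r s = (r * g) ^+ 2 * ((r ^+ 2 + s ^+ 2) * h).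
Proof. rewrite /sol_a; ring. Qed.

Lemma sol_bE : sol_b r s = (s * f * g) ^+ 2 * (r ^+ 2 + s ^+ 2).
Proof. rewrite /sol_b; ring. Qed.

Lemma sol_cE : sol_c r s = (2 * r ^+ 2 * s ^+ 2 * f) ^+ 2 * h.
Proof. rewrite /sol_c; ring. Qed.

End Identities.

Section SumsOfTwoSquares.

Variables (R : idomainType) (u v : R).
Hypotheses (u0 : u != 0) (v0 : v != 0) (uv1 : u ^+ 2 + v ^+ 2 = 1).

(* A vanishing summand is removed by y^2 = (u y)^2 + (v y)^2. *)
Lemma sum_of_two_nonzero_squaresI (y z : R) :
  y ^+ 2 + z ^+ 2 != 0 -> sum_of_two_nonzero_squares (y ^+ 2 + z ^+ 2).
Proof.
have split_sqr (w : R) : w ^+ 2 != 0 -> sum_of_two_nonzero_squares (w ^+ 2).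
  rewrite expf_eq0 /= => w0; exists (u * w), (v * w).
  by rewrite !mulf_neq0 // !exprMn -mulrDl uv1 mul1r.
have [->|y0] := eqVneq y 0; first by rewrite expr0n add0r => /split_sqr.
have [->|z0] := eqVneq z 0; first by rewrite expr0n addr0 => /split_sqr.
by exists y, z.
Qed.

Lemma sol_sums_of_two_nonzero_squares (r s : R) :
  sol_a r s != 0 -> sol_b r s != 0 -> sol_c r s != 0 ->
  all_sums_of_two_nonzero_squares (sol_a r s) (sol_b r s) (sol_c r s).
Proof.
rewrite sol_aE sol_bE sol_cE factor12_sum_of_squares.
move: (factor6 r s) (factor8 r s) => f g.
set p := _ - _ * _ - _ + _; set q := 4 * _ * _ * _.
have -> : (r * g) ^+ 2 * ((r ^+ 2 + s ^+ 2) * (p ^+ 2 + q ^+ 2))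
    = (r * g * (r * p - s * q)) ^+ 2 + (r * g * (r * q + s * p)) ^+ 2.
  by ring.
by rewrite !mulrDr -!exprMn => a0 b0 c0;
  split; [|split]; apply: sum_of_two_nonzero_squaresI.
Qed.

End SumsOfTwoSquares.

Section NonzeroFactors.

Variables (r s : int).
Hypotheses (r0 : r != 0) (s0 : s != 0).

Let r2_gt0 : 0 < r ^+ 2. Proof. by rewrite lt_def sqr_ge0 expf_neq0. Qed.
Let s2_gt0 : 0 < s ^+ 2. Proof. by rewrite lt_def sqr_ge0 expf_neq0. Qed.

Lemma sum_sqr_neq0 : r ^+ 2 + s ^+ 2 != 0.
Proof. by rewrite gt_eqF // addr_gt0. Qed.

Lemma factor6_neq0 : factor6 r s != 0.
Proof.
rewrite gt_eqF // /factor6 -[6%N]/(2 * 3)%N -[4%N]/(2 * 2)%N !exprM.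
move: (r ^+ 2) (s ^+ 2) r2_gt0 s2_gt0 => x y x0 y0.
by do !apply: addr_gt0; do ?apply: mulr_gt0; rewrite ?exprn_gt0.
Qed.

Lemma factor12_neq0 : factor12 r s != 0.
Proof.
rewrite gt_eqF // /factor12 -[14%N]/(2 * 7)%N -[12%N]/(2 * 6)%N -[10%N]/(2 * 5)%N.
rewrite -[8%N]/(2 * 4)%N -[6%N]/(2 * 3)%N -[4%N]/(2 * 2)%N !exprM.
move: (r ^+ 2) (s ^+ 2) r2_gt0 s2_gt0 => x y x0 y0.
by do !apply: addr_gt0; do ?apply: mulr_gt0; rewrite ?exprn_gt0.
Qed.

End NonzeroFactors.

Lemma factor8_F3_eq0 (x y : 'F_3) : factor8 x y = 0 -> x = 0 /\ y = 0.
Proof.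
have: (factor8 x y == 0) ==> (x == 0) && (y == 0).
  by case: x y => [[|[|[|x]]] ?] [[|[|[|y]]] ?].
by move=> /implyP xy0 /eqP /xy0 /andP[/eqP-> /eqP->].
Qed.

Lemma factor8_scale (R : comNzRingType) (d r s : R) :
  factor8 (d * r) (d * s) = d ^+ 8 * factor8 r s.
Proof. rewrite /factor8; ring. Qed.

Lemma factor8_neq0 (r s : int) : r != 0 -> factor8 r s != 0.
Proof.
move=> r0; apply/eqP.
have d0 : gcdz r s != 0 by rewrite gcdz_eq0 negb_and r0.
have [x Hx] := dvdzP (dvdz_gcdl r s); have [y Hy] := dvdzP (dvdz_gcdr r s).
have cop : gcdz x y = 1.
  apply: (mulIf d0); rewrite mul1r.
  by rewrite [RHS](congr2 gcdz Hx Hy) -mulz_gcdl.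
move: (gcdz r s) d0 Hx Hy => d d0 -> ->.
rewrite ![_ * d]mulrC factor8_scale => /eqP.
rewrite mulf_eq0 expf_eq0 /= (negPf d0) /= => /eqP g0.
have [x3 y3] : x%:~R = 0 :> 'F_3 /\ y%:~R = 0 :> 'F_3.
  apply: factor8_F3_eq0; rewrite -[RHS](rmorph0 (intr : {rmorphism int -> 'F_3})).
  rewrite -g0 /factor8 !(rmorphB, rmorphD, rmorphM, rmorphXn) /=; ring.
have dvd3 (z : int) : z%:~R = 0 :> 'F_3 -> (3 %| z)%Z.
  by move=> z3; rewrite (dvdz_pcharf (pchar_Fp (isT : prime 3))) z3.
have : (3 %| gcdz x y)%Z by rewrite dvdz_gcd !dvd3.
by rewrite cop.
Qed.

Lemma nonsquare_atI (r s : int) :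
  r != 0 -> s != 0 ->
  ~ is_square (16 ^+ 2 * ((r ^+ 2 + s ^+ 2) * factor12 r s)) ->
  ~ is_square (r ^+ 2 + s ^+ 2) -> ~ is_square (factor12 r s) ->
  nonsquare_at r s.
Proof.
move=> r0 s0 Na Nb Nc; have g0 := factor8_neq0 s r0.
have f0 := factor6_neq0 r0 s0; rewrite /nonsquare_at sol_aE sol_bE sol_cE.
split; [|split].
- by move=> /is_square_mulKl-/(_ (mulf_neq0 r0 g0)) /(is_square_mull 16).
- by move=> /is_square_mulKl-/(_ (mulf_neq0 (mulf_neq0 s0 f0) g0)).
by move=> /is_square_mulKl => Hc; apply/Nc/Hc; rewrite !mulf_neq0 ?expf_neq0.
Qed.

Lemma eventually_nonsquare_at_s (r : int) :
  r != 0 -> eventually (fun s => nonsquare_at r s).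
Proof.
move=> r0.
(* The polynomial part of the square root in s, scaled by 16 for n h; large
   coefficients are split because numerals are unary. *)
have Ha := @eventually_nonsquare
  [:: 0; 539 * r ^+ 6; 0; 102 * r ^+ 4; 0; 120 * r ^+ 2; 0]
  [:: 256 * r ^+ 14; 0; - (288 * 1000 + 729) * r ^+ 12; 0;
     - (86 * 1000 + 148) * r ^+ 10; 0]
  16 (- (12 * 7487) * r ^+ 8).
have Hb := @eventually_nonsquare [:: 0] [::] 1 (r ^+ 2).
have Hc := @eventually_nonsquare
  [:: 33 * r ^+ 6; 0; 3 * r ^+ 4; 0; 7 * r ^+ 2; 0]
  [:: - 1088 * r ^+ 12; 0; - 192 * r ^+ 10; 0] 1 (- 384 * r ^+ 8).
have {}Ha : eventually _ :=
  Ha isT ltac:(by rewrite mulf_neq0 ?oppr_eq0 ?mulf_neq0 ?expf_neq0) isT.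
have {}Hb := Hb isT (expf_neq0 2 r0) isT.
have {}Hc : eventually _ :=
  Hc isT ltac:(by rewrite mulf_neq0 ?oppr_eq0 ?expf_neq0) isT.
apply: (eventually_impl (eventually_and eventually_neq0
  (eventually_and Ha (eventually_and Hb Hc)))) => s [s0 [{}Ha [{}Hb {}Hc]]].
apply: nonsquare_atI => //.
- move: Ha; congr (~ is_square _); rewrite /factor12 /=; ring.
- move: Hb; congr (~ is_square _); rewrite /=; ring.
- move: Hc; congr (~ is_square _); rewrite /factor12 /=; ring.
Qed.

Lemma eventually_nonsquare_at_r (s : int) :
  s != 0 -> eventually (fun r => nonsquare_at r s).
Proof.
move=> s0.
have Ha := @eventually_nonsquare
  [:: 0; - 701 * s ^+ 6; 0; 646 * s ^+ 4; 0; 56 * s ^+ 2; 0]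
  [:: 256 * s ^+ 14; 0; - (487 * 1000 + 561) * s ^+ 12; 0;
     (923 * 1000 + 356) * s ^+ 10; 0]
  16 (- (4 * 13 * 29 * 197) * s ^+ 8).
have Hb := @eventually_nonsquare [:: 0] [::] 1 (s ^+ 2).
have Hc := @eventually_nonsquare
  [:: - 63 * s ^+ 6; 0; 39 * s ^+ 4; 0; 3 * s ^+ 2; 0]
  [:: - 3968 * s ^+ 12; 0; 4928 * s ^+ 10; 0] 1 (- 1088 * s ^+ 8).
have {}Ha : eventually _ :=
  Ha isT ltac:(by rewrite mulf_neq0 ?oppr_eq0 ?mulf_neq0 ?expf_neq0) isT.
have {}Hb := Hb isT (expf_neq0 2 s0) isT.
have {}Hc : eventually _ :=
  Hc isT ltac:(by rewrite mulf_neq0 ?oppr_eq0 ?expf_neq0) isT.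
apply: (eventually_impl (eventually_and eventually_neq0
  (eventually_and Ha (eventually_and Hb Hc)))) => r [r0 [{}Ha [{}Hb {}Hc]]].
apply: nonsquare_atI => //.
- move: Ha; congr (~ is_square _); rewrite /factor12 /=; ring.
- move: Hb; congr (~ is_square _); rewrite /=; ring.
- move: Hc; congr (~ is_square _); rewrite /factor12 /=; ring.
Qed.

Lemma rmorph_sol (A B : comNzRingType) (phi : {rmorphism A -> B})
    (r s : A) (r' s' : B) :
  phi r = r' -> phi s = s' ->
  [/\ phi (sol_a r s) = sol_a r' s', phi (sol_b r s) = sol_b r' s' &
      phi (sol_c r s) = sol_c r' s'].
Proof.
move=> <- <-.
by split; rewrite /sol_a /sol_b /sol_c /factor6 /factor8 /factor12
  !(rmorphXn, rmorph_nat, rmorphB, rmorphD, rmorphM).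
Qed.

Lemma meval_sol_11 (v := fun=> 1 : rat) :
  [/\ poly_a.@[v] = 64 ^+ 2 * 34%:~R, poly_b.@[v] = 192 ^+ 2 * 2%:~R &
      poly_c.@[v] = 96 ^+ 2 * 17%:~R].
Proof.
have [Ha Hb Hc] :=
  @rmorph_sol _ _ (meval v) Xr Xs 1 1 (mevalXU v _) (mevalXU v _).
by split; [rewrite [LHS]Ha | rewrite [LHS]Hb | rewrite [LHS]Hc];
  rewrite /sol_a /sol_b /sol_c /factor6 /factor8 /factor12; ring.
Qed.

Lemma Xr_exp_homog (i : nat) : Xr ^+ i \is i.-homog.
Proof.
by rewrite -[X in X.-homog]mul1n; apply: dhomogMn; rewrite dhomogX /= mdeg1.
Qed.

Lemma Xs_exp_homog (j : nat) : Xs ^+ j \is j.-homog.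
Proof.
by rewrite -[X in X.-homog]mul1n; apply: dhomogMn; rewrite dhomogX /= mdeg1.
Qed.

Lemma scaled_Xr_exp_homog (c i : nat) : c%:R * Xr ^+ i \is i.-homog.
Proof. by rewrite mulr_natl rpredMn // Xr_exp_homog. Qed.

Lemma monomial_homog (c i j : nat) :
  c%:R * Xr ^+ i * Xs ^+ j \is (i + j).-homog.
Proof. exact: dhomogM (scaled_Xr_exp_homog c i) (Xs_exp_homog j). Qed.

Lemma factor6_homog : factor6 Xr Xs \is 6.-homog.
Proof.
apply: (rpredD _ (Xs_exp_homog 6)).
apply: (rpredD _ (monomial_homog 3 2 4)).
exact: (rpredD (scaled_Xr_exp_homog 5 6) (monomial_homog 3 4 2)).
Qed.

Lemma factor8_homog : factor8 Xr Xs \is 8.-homog.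
Proof.
apply: (rpredB _ (Xs_exp_homog 8)).
apply: (rpredB _ (monomial_homog 6 2 6)).
apply: (rpredB _ (monomial_homog 12 4 4)).
exact: (rpredD (Xr_exp_homog 8) (monomial_homog 2 6 2)).
Qed.

Lemma factor12_homog : factor12 Xr Xs \is 12.-homog.
Proof.
apply: (rpredD _ (Xs_exp_homog 12)).
apply: (rpredD _ (monomial_homog 14 2 10)).
apply: (rpredD _ (monomial_homog 55 4 8)).
apply: (rpredD _ (monomial_homog 108 6 6)).
apply: (rpredD _ (monomial_homog 87 8 4)).
exact: (rpredD (Xr_exp_homog 12) (monomial_homog 6 10 2)).
Qed.

Lemma has_degree_dhomog (p : {mpoly rat[2]}) (d : nat) :
  p != 0 -> p \is d.-homog -> has_degree p d.
Proof.
by move=> p0 /dhomogP hp; rewrite /has_degree -mlead_deg // hp ?mlead_supp.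
Qed.

Lemma sol_homog :
  [/\ poly_a \is 32.-homog, poly_b \is 32.-homog & poly_c \is 32.-homog].
Proof.
have r2 := Xr_exp_homog 2; have s2 := Xs_exp_homog 2.
have n2 : Xr ^+ 2 + Xs ^+ 2 \is 2.-homog := rpredD r2 s2.
have f12 := dhomogMn 2 factor6_homog; have g16 := dhomogMn 2 factor8_homog.
have h12 := factor12_homog.
split.
- exact: dhomogM (dhomogM (dhomogM r2 n2) g16) h12.
- exact: dhomogM (dhomogM (dhomogM s2 n2) f12) g16.
exact: dhomogM (dhomogM (monomial_homog 4 4 4) f12) h12.
Qed.

Lemma poly_sol_neq0 : [/\ poly_a != 0, poly_b != 0 & poly_c != 0].
Proof.
have [Ha Hb Hc] := meval_sol_11.
have nz (p : {mpoly rat[2]}) (d n : rat) :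
    p.@[fun=> 1] = d ^+ 2 * n -> d != 0 -> n != 0 -> p != 0.
  move=> Hp d0 n0; apply: contra_eq_neq Hp => ->.
  by rewrite meval0 eq_sym mulf_neq0 ?expf_neq0.
by split; [exact: nz Ha isT isT | exact: nz Hb isT isT | exact: nz Hc isT isT].
Qed.

Lemma poly_sol_nonsquare : none_square poly_a poly_b poly_c.
Proof.
have [Ha Hb Hc] := meval_sol_11.
have nsq (p : {mpoly rat[2]}) (d : rat) (n : int) :
    p.@[fun=> 1] = d ^+ 2 * n%:~R -> d != 0 -> ~ is_square n -> ~ is_square p.
  move=> Hp d0 n_nsq [q Hq]; apply/n_nsq/(is_square_rat_mulKl d0).
  by exists q.@[fun=> 1]; rewrite -Hp Hq rmorphXn.
split; [|split].
- by apply: nsq Ha isT _; exact: (@sqr_plus_small_nonsquare 6 (- 2)).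
- by apply: nsq Hb isT _; exact: (@sqr_plus_small_nonsquare 2 (- 2)).
by apply: nsq Hc isT _; exact: (@sqr_plus_small_nonsquare 4 1).
Qed.

Lemma poly_sol_sums_of_two_squares :
  all_sums_of_two_nonzero_squares poly_a poly_b poly_c.
Proof.
have [a0 b0 c0] := poly_sol_neq0.
apply: (@sol_sums_of_two_nonzero_squares {mpoly rat[2]}
  ((3 / 5)%:MP) ((4 / 5)%:MP)) => //.
- by rewrite mpolyC_eq0.
- by rewrite mpolyC_eq0.
by rewrite !expr2 -!mpolyCM -mpolyCD -mpolyC1; congr (_%:MP); field.
Qed.

Lemma rat_sol_sums_of_two_squares (r s : int) :
  r != 0 -> s != 0 ->
  all_sums_of_two_nonzero_squares ((sol_a r s)%:~R : rat)
    ((sol_b r s)%:~R : rat) ((sol_c r s)%:~R : rat).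
Proof.
move=> r0 s0; have [Ea Eb Ec] :=
  @rmorph_sol _ _ (intr : {rmorphism int -> rat}) r s _ _ erefl erefl.
have [f0 g0 h0] := And3 (factor6_neq0 r0 s0) (factor8_neq0 s r0)
  (factor12_neq0 r0 s0).
have rs0 := sum_sqr_neq0 r0 s0.
rewrite Ea Eb Ec.
apply: (@sol_sums_of_two_nonzero_squares rat (3 / 5) (4 / 5)) => //.
- by rewrite -Ea intr_eq0 sol_aE !mulf_neq0 ?expf_neq0 ?mulf_neq0.
- by rewrite -Eb intr_eq0 sol_bE !mulf_neq0 ?expf_neq0 ?mulf_neq0.
by rewrite -Ec intr_eq0 sol_cE !mulf_neq0 ?expf_neq0 ?mulf_neq0 ?expf_neq0.
Qed.

Theorem mainTheorem4 :
  (* the elementary symmetric functions are perfect squares, for all integers *)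
  (forall r s : int,
     let a := sol_a r s in let b := sol_b r s in let c := sol_c r s in
     is_square (a + b + c) /\ is_square (a * b + b * c + c * a) /\
     is_square (a * b * c))
  /\
  (* the parametric solution: polynomials of degree 32 *)
  (has_degree poly_a 32 /\ has_degree poly_b 32 /\ has_degree poly_c 32)
  /\
  (* none is a square: as polynomials, and as integers for fixed nonzero value
     of one parameter and all but finitely many values of the other *)
  (none_square poly_a poly_b poly_c
   /\ (forall r : int, r != 0 ->
         exists N : int, forall s : int, N < `|s| -> nonsquare_at r s)
   /\ (forall s : int, s != 0 ->
         exists N : int, forall r : int, N < `|r| -> nonsquare_at r s))
  /\
  (* sums of two nonzero squares: as polynomials over the rationals, and as
     integers, of rational numbers, for all nonzero parameters *)
  (all_sums_of_two_nonzero_squares poly_a poly_b poly_c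
   /\ (forall r s : int, r != 0 -> s != 0 ->
         all_sums_of_two_nonzero_squares
           ((sol_a r s)%:~R : rat) ((sol_b r s)%:~R : rat)
           ((sol_c r s)%:~R : rat))).
Proof.
split; [|split; [|split]].
- move=> r s; split; [|split].
  + exact: sol_sum_is_square.
  + exact: sol_pair_sum_is_square.
  exact: sol_prod_is_square.
- have [a0 b0 c0] := poly_sol_neq0; have [ha hb hc] := sol_homog.
  by split; [|split]; [exact: has_degree_dhomog a0 ha
    | exact: has_degree_dhomog b0 hb | exact: has_degree_dhomog c0 hc].
- split; first exact: poly_sol_nonsquare.
  split; [exact: eventually_nonsquare_at_s | exact: eventually_nonsquare_at_r].
split; [exact: poly_sol_sums_of_two_squares | exact: rat_sol_sums_of_two_squares].
Qed.
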